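(* Let $m,n\in\mathbb{N}$, let $\mathbf{A}\in\mathbb{IR}^{m\times n}$ be an interval matrix, $\mathbf{b}\in\mathbb{IR}^m$ an interval vector, $\mathcal{A}\in\{\forall,\exists\}^{m\times n}$ a quantifier matrix, $\beta\in\{\forall,\exists\}^m$ a quantifier vector, and let $Q(\mathbf{A},\mathbf{b},\mathcal{A},\beta)$ be a corresponding quantifier prefix with an arbitrary order of its elementary prefixes. Then for every $x\in\mathbb{R}^n$, $$Q(\mathbf{A},\mathbf{b},\mathcal{A},\beta)\ (Ax\ge b)\ \Longleftrightarrow\ \underline{\mathbf{A}^{\forall}x}+\overline{\mathbf{A}^{\exists}x}\ge\overline{\mathbf{b}^{\forall}}+\underline{\mathbf{b}^{\exists}}\ \Longleftrightarrow\ \underline{\mathbf{A}^{\mathfrak{c}}x}\ge\underline{\mathbf{b}^{\mathfrak{c}}},$$ $$Q(\mathbf{A},\mathbf{b},\mathcal{A},\beta)\ (Ax\le b)\ \Longleftrightarrow\ \overline{\mathbf{A}^{\forall}x}+\underline{\mathbf{A}^{\exists}x}\le\underline{\mathbf{b}^{\forall}}+\overline{\mathbf{b}^{\exists}}\ \Longleftrightarrow\ \overline{\mathbf{A}^{\mathfrak{c}}x}\le\overline{\mathbf{b}^{\mathfrak{c}}}.$$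
   Context: Intervals. $\mathbb{KR}$ (Kaucher intervals) is the set of all pairs $\mathbf{u}=[\underline{\mathbf{u}},\overline{\mathbf{u}}]$ with $\underline{\mathbf{u}},\overline{\mathbf{u}}\in\mathbb{R}$ (no order required between the endpoints); $\mathbb{IR}\subset\mathbb{KR}$ consists of those with $\underline{\mathbf{u}}\le\overline{\mathbf{u}}$, identified with the sets $\{u\in\mathbb{R}:\underline{\mathbf{u}}\le u\le\overline{\mathbf{u}}\}$. A real $\lambda$ is identified with $[\lambda,\lambda]$. $\operatorname{dual}\mathbf{u}=[\overline{\mathbf{u}},\underline{\mathbf{u}}]$. Addition: $\mathbf{u}+\mathbf{v}=[\underline{\mathbf{u}}+\underline{\mathbf{v}},\overline{\mathbf{u}}+\overline{\mathbf{v}}]$; multiplication by a real: $\lambda\mathbf{u}=[\lambda\underline{\mathbf{u}},\lambda\overline{\mathbf{u}}]$ for $\lambda\ge0$ and $\lambda\mathbf{u}=[\lambda\overline{\mathbf{u}},\lambda\underline{\mathbf{u}}]$ for $\lambda\le0$. For an interval matrix $\mathbf{M}$ and $x\in\mathbb{R}^n$, $(\mathbf{M}x)_i=\sum_j x_j\mathbf{M}_{ij}$. For vectors and matrices, endpoints (underline for lower/left, overline for upper/right), inequalities, addition and $\operatorname{dual}$ are componentwise. Quantifier prefixes. With each parameter $A_{ij}$ associate the elementary prefix $(\mathcal{A}_{ij}\,A_{ij}\in\mathbf{A}_{ij})$, and with each parameter $b_i$ the elementary prefix $(\beta_i\,b_i\in\mathbf{b}_i)$. $Q(\mathbf{A},\mathbf{b},\mathcal{A},\beta)$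 denotes a prefix of length $m(n+1)$ containing each of these elementary prefixes exactly once, in an arbitrary order. The predicates $Q(\mathbf{A},\mathbf{b},\mathcal{A},\beta)\,(Ax\ge b)$ and $Q(\mathbf{A},\mathbf{b},\mathcal{A},\beta)\,(Ax\le b)$ have free variable $x\in\mathbb{R}^n$; $Ax\ge b$ and $Ax\le b$ are the conjunctions over $i$ of $\sum_j A_{ij}x_j\ge b_i$, respectively $\sum_j A_{ij}x_j\le b_i$. Derived matrices and vectors: $\mathbf{A}^{\forall}_{ij}=\mathbf{A}_{ij}$ if $\mathcal{A}_{ij}=\forall$ and $0$ if $\mathcal{A}_{ij}=\exists$; $\mathbf{A}^{\exists}_{ij}=\mathbf{A}_{ij}$ if $\mathcal{A}_{ij}=\exists$ and $0$ if $\mathcal{A}_{ij}=\forall$; $\mathbf{b}^{\forall}_i=\mathbf{b}_i$ if $\beta_i=\forall$ and $0$ if $\beta_i=\exists$; $\mathbf{b}^{\exists}_i=\mathbf{b}_i$ if $\beta_i=\exists$ and $0$ if $\beta_i=\forall$; $\mathbf{A}^{\mathfrak{c}}_{ij}=\mathbf{A}_{ij}$ if $\mathcal{A}_{ij}=\forall$ and $\operatorname{dual}\mathbf{A}_{ij}$ if $\mathcal{A}_{ij}=\exists$; $\mathbf{b}^{\mathfrak{c}}_i=\operatorname{dual}\mathbf{b}_i$ if $\beta_i=\forall$ and $\mathbf{b}_i$ if $\beta_i=\exists$. *)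

(* Defs.v *)
(* MathComp world; the real line is an arbitrary [R : realType]. *)
From HB Require Import structures.
From mathcomp Require Export all_boot all_order all_algebra.
From mathcomp Require Export reals.

Set Implicit Arguments.
Unset Strict Implicit.
Unset Printing Implicit Defensive.

Import Order.TTheory GRing.Theory Num.Theory.
Local Open Scope ring_scope.

(* Kaucher intervals: no order is imposed on the endpoints. *)
Record kaucher (R : Type) := Kaucher { lo : R; up : R }.

Section Intervals.
Variable R : realType.
Implicit Types (u v : kaucher R) (l t : R).

(* Membership of [u] in IR, the subset of proper intervals. *)
Definition proper_itv u : Prop := lo u <= up u.

Definition in_kaucher u t : Prop := lo u <= t <= up u.

Definition kreal l : kaucher R := Kaucher l l.

Definition dual u : kaucher R := Kaucher (up u) (lo u).

Definition kadd u v : kaucher R := Kaucher (lo u + lo v) (up u + up v).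

Definition kscale l u : kaucher R :=
  if 0 <= l then Kaucher (l * lo u) (l * up u)
  else Kaucher (l * up u) (l * lo u).

Definition kmulmx m n (M : 'M[kaucher R]_(m, n)) (x : 'cV[R]_n) :
    'cV[kaucher R]_m :=
  \col_i \big[kadd/kreal 0]_(j < n) kscale (x j 0) (M i j).

Definition lo_mx m n (M : 'M[kaucher R]_(m, n)) : 'M[R]_(m, n) :=
  map_mx (@lo R) M.

Definition up_mx m n (M : 'M[kaucher R]_(m, n)) : 'M[R]_(m, n) :=
  map_mx (@up R) M.

Definition le_mx m n (M N : 'M[R]_(m, n)) : Prop :=
  forall i j, M i j <= N i j.

End Intervals.

Inductive quantifier := QAll | QEx.

(* The m(n+1) parameters: [inl (i, j)] is A_ij and [inr i] is b_i. *)
Definition param (m n : nat) : Type := ('I_m * 'I_n + 'I_m)%type.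
HB.instance Definition _ m n := Finite.on (param m n).

Section Prefixes.
Variables (R : realType) (m n : nat).
Variables (A : 'M[kaucher R]_(m, n)) (b : 'cV[kaucher R]_m).
Variables (cA : 'M[quantifier]_(m, n)) (beta : 'cV[quantifier]_m).

Definition param_itv (p : param m n) : kaucher R :=
  match p with inl ij => A ij.1 ij.2 | inr i => b i 0 end.

Definition param_quant (p : param m n) : quantifier :=
  match p with inl ij => cA ij.1 ij.2 | inr i => beta i 0 end.

(* The quantifier and the interval of an elementary prefix are determined by
   its parameter, so a prefix is given by the order of its parameters, the
   outermost (leftmost) one first. *)
Definition is_prefix (Q : seq (param m n)) : Prop :=
  forall p, count_mem p Q = 1%N.

(* [quantify Q phi v]: the formula [phi] preceded by the prefix [Q], where [v]
   gives the values of the parameters that are not bound by [Q]. *)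
Fixpoint quantify (Q : seq (param m n)) (phi : (param m n -> R) -> Prop)
    (v : param m n -> R) : Prop :=
  match Q with
  | [::] => phi v
  | p :: Q' =>
      match param_quant p with
      | QAll => forall t, in_kaucher (param_itv p) t ->
                  quantify Q' phi [eta v with p |-> t]
      | QEx => exists2 t, in_kaucher (param_itv p) t &
                  quantify Q' phi [eta v with p |-> t]
      end
  end.

(* The initial valuation 0 is irrelevant when [is_prefix Q] holds, as every
   parameter is then bound. *)
Definition quantified (Q : seq (param m n))
    (phi : 'M[R]_(m, n) -> 'cV[R]_m -> Prop) : Prop :=
  quantify Q
    (fun v => phi (\matrix_(i, j) v (inl (i, j))) (\col_i v (inr i)))
    (fun=> 0).

Definition Aforall : 'M[kaucher R]_(m, n) :=
  \matrix_(i, j) match cA i j with QAll => A i j | QEx => kreal 0 end.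

Definition Aexists : 'M[kaucher R]_(m, n) :=
  \matrix_(i, j) match cA i j with QAll => kreal 0 | QEx => A i j end.

Definition bforall : 'cV[kaucher R]_m :=
  \col_i match beta i 0 with QAll => b i 0 | QEx => kreal 0 end.

Definition bexists : 'cV[kaucher R]_m :=
  \col_i match beta i 0 with QAll => kreal 0 | QEx => b i 0 end.

Definition Achar : 'M[kaucher R]_(m, n) :=
  \matrix_(i, j) match cA i j with QAll => A i j | QEx => dual (A i j) end.

Definition bchar : 'cV[kaucher R]_m :=
  \col_i match beta i 0 with QAll => dual (b i 0) | QEx => b i 0 end.

End Prefixes.

(* Main.v *)
Require Import Defs.
From mathcomp Require Import all_boot all_order all_algebra reals.

Import Order.TTheory GRing.Theory Num.Theory.
Local Open Scope ring_scope.

(** Every parameter occurs in exactly one of the m inequalities, and its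
    coefficient there, x_j for A_ij and -1 or 1 for b_i, is known once x is
    fixed. Hence it is known in advance, and independently of the values of the
    other parameters, which endpoint of its interval makes the system hardest
    to satisfy and which makes it easiest. A universal quantifier may therefore
    be replaced by the substitution of the hardest endpoint, an existential one
    by that of the easiest endpoint, and neither choice depends on the position
    of the quantifier in the prefix ([quantify_extremal]). So the quantified
    system is equivalent, whatever the order of the prefix, to one ordinary
    system of inequalities ([quantify_monotone]).

    Since [dual] exchanges the endpoints, the substituted values are endpoints
    of the characteristic matrix and vector, and the resulting inequalities are
    literally those between the endpoints of [Achar] times x and of [bchar].
    The middle condition has the same two sides: a row of the product
    splits into its universal and existential terms, and for the latter the
    opposite endpoint of [l u] is the endpoint of [l (dual u)]. *)

(** * Endpoints of interval matrix-vector products *)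

Section Endpoints.
Variable R : realType.
Implicit Types (u : kaucher R) (l t : R).

Lemma lo_kscale l u : lo (kscale l u) = l * (if 0 <= l then lo u else up u).
Proof. by rewrite /kscale; case: ifP. Qed.

Lemma up_kscale l u : up (kscale l u) = l * (if 0 <= l then up u else lo u).
Proof. by rewrite /kscale; case: ifP. Qed.

Lemma kscale_kreal0 l : kscale l (kreal 0) = kreal 0 :> kaucher R.
Proof. by rewrite /kscale /kreal /= mulr0; case: ifP. Qed.

Lemma lo_kscale_dual l u : lo (kscale l (dual u)) = up (kscale l u).
Proof. by rewrite lo_kscale up_kscale. Qed.

Lemma up_kscale_dual l u : up (kscale l (dual u)) = lo (kscale l u).
Proof. by rewrite lo_kscale up_kscale. Qed.

Variables m n : nat.
Implicit Types (M : 'M[kaucher R]_(m, n)) (x : 'cV[R]_n).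

Lemma lo_kmulmxE M x i k :
  lo_mx (kmulmx M x) i k = \sum_j lo (kscale (x j 0) (M i j)).
Proof. by rewrite !mxE; apply: (big_morph (@lo R)). Qed.

Lemma up_kmulmxE M x i k :
  up_mx (kmulmx M x) i k = \sum_j up (kscale (x j 0) (M i j)).
Proof. by rewrite !mxE; apply: (big_morph (@up R)). Qed.

End Endpoints.

(** * Elimination of quantifiers over monotone predicates *)

Section Elimination.
Variables (R : realType) (m n : nat).
Variables (A : 'M[kaucher R]_(m, n)) (b : 'cV[kaucher R]_m).
Variables (cA : 'M[quantifier]_(m, n)) (beta : 'cV[quantifier]_m).

Local Notation pitv := (param_itv A b).
Local Notation pquant := (param_quant cA beta).
Implicit Types (p : param m n) (Q : seq (param m n)).
Implicit Types (v w e s : param m n -> R) (phi : (param m n -> R) -> Prop).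

(** The two inequalities are strategies: [e p] is the best move at [p] of the
    player who owns that quantifier, the refuter for a universal one and the
    verifier for an existential one. Since the best move is the same in every
    state [v] of the game, each quantifier collapses to a substitution. *)
Lemma quantify_extremal Q phi e v :
  uniq Q ->
  (forall w w', w =1 w' -> phi w -> phi w') ->
  (forall p, in_kaucher (pitv p) (e p)) ->
  (forall p w t, in_kaucher (pitv p) t -> pquant p = QAll ->
     phi [eta w with p |-> e p] -> phi [eta w with p |-> t]) ->
  (forall p w t, in_kaucher (pitv p) t -> pquant p = QEx ->
     phi [eta w with p |-> t] -> phi [eta w with p |-> e p]) ->
  quantify A b cA beta Q phi v <-> phi (fun p => if p \in Q then e p else v p).
Proof.
move=> + phi_ext e_in phi_all phi_ex.
elim: Q v => [|p Q IHQ] v //= /andP[pQ uQ].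
(* The remaining prefix does not rebind [p], so the value given to [p] can be
   substituted after all the later ones. *)
have swap t : (fun q => if q \in Q then e q else [eta v with p |-> t] q)
    =1 [eta (fun q => if q \in Q then e q else v q) with p |-> t].
  by move=> q /=; case: (eqVneq q p) => [->|//]; rewrite (negPf pQ).
have headE : [eta (fun q => if q \in Q then e q else v q) with p |-> e p]
    =1 (fun q => if q \in p :: Q then e q else v q).
  by move=> q /=; rewrite in_cons; case: (eqVneq q p) => [->|].
case p_quant: (pquant p).
- split=> [/(_ _ (e_in p))/(IHQ _ uQ)/(phi_ext _ _ (swap _))|phi_e t t_in].
    exact: (phi_ext _ _ headE).
  apply/(IHQ _ uQ); apply: (phi_ext _ _ (fsym (swap t))).
  by apply: phi_all => //; apply: (phi_ext _ _ (fsym headE)).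
- split=> [[t t_in /(IHQ _ uQ)/(phi_ext _ _ (swap _)) phi_t]|phi_e].
    by apply: (phi_ext _ _ headE); apply: (phi_ex _ _ t).
  exists (e p) => //; apply/(IHQ _ uQ); apply: (phi_ext _ _ (fsym (swap _))).
  exact: (phi_ext _ _ (fsym headE)).
Qed.

(** Over a proper [u], the endpoint at which [l * t] is least when the quantifier
    is universal and greatest when it is existential. Going through [dual] makes
    it an endpoint of the characteristic interval by conversion. *)
Definition extremal (l : R) (q : quantifier) (u : kaucher R) : R :=
  let u' := if q is QAll then u else dual u in if 0 <= l then lo u' else up u'.

Hypothesis proper_params : forall p, proper_itv (pitv p).

Lemma extremal_in l q p : in_kaucher (pitv p) (extremal l q (pitv p)).
Proof.
rewrite /in_kaucher /extremal; have := proper_params p; rewrite /proper_itv.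
by case: q; case: ifP => _ /= ->; rewrite lexx.
Qed.

Lemma extremal_all l p t : in_kaucher (pitv p) t ->
  l * extremal l QAll (pitv p) <= l * t.
Proof.
move=> /andP[lo_t t_up]; rewrite /extremal; case: (leP 0 l) => [l_ge0|/ltW l_le0].
  exact: ler_wpM2l.
exact: ler_wnM2l.
Qed.

Lemma extremal_ex l p t : in_kaucher (pitv p) t ->
  l * t <= l * extremal l QEx (pitv p).
Proof.
move=> /andP[lo_t t_up]; rewrite /extremal; case: (leP 0 l) => [l_ge0|/ltW l_le0].
  exact: ler_wpM2l.
exact: ler_wnM2l.
Qed.

(** The sign of [s p] tells in which direction [p] must move to make [phi]
    easier. Using the product [s p * v p] instead of a case distinction also
    covers weight 0, where [phi] does not depend on [p] at all. *)
Lemma quantify_monotone Q phi s v :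
  is_prefix Q ->
  (forall w w', (forall p, s p * w p <= s p * w' p) -> phi w -> phi w') ->
  quantify A b cA beta Q phi v <->
  phi (fun p => extremal (s p) (pquant p) (pitv p)).
Proof.
move=> Q_prefix phi_mono.
have phi_ext w w' : w =1 w' -> phi w -> phi w'.
  by move=> eq_w; apply: phi_mono => p; rewrite eq_w.
have mem_Q p : p \in Q by rewrite -has_pred1 has_count Q_prefix.
have uniq_Q : uniq Q by apply/count_mem_uniq => p; rewrite Q_prefix mem_Q.
rewrite (quantify_extremal Q phi (fun p => extremal (s p) (pquant p) (pitv p))) //.
- by split; apply: phi_ext => p; rewrite mem_Q.
- by move=> p; apply: extremal_in.
- move=> p w t t_in p_all; apply: phi_mono => q /=.
  by case: eqVneq => // ->; rewrite p_all extremal_all.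
- move=> p w t t_in p_ex; apply: phi_mono => q /=.
  by case: eqVneq => // ->; rewrite p_ex extremal_ex.
Qed.

End Elimination.

(** * The quantified systems of inequalities *)

Section Systems.
Variables (R : realType) (m n : nat).
Variables (A : 'M[kaucher R]_(m, n)) (b : 'cV[kaucher R]_m).
Variables (cA : 'M[quantifier]_(m, n)) (beta : 'cV[quantifier]_m).

Lemma lo_Achar_split (x : 'cV[R]_n) :
  lo_mx (kmulmx (Aforall A cA) x) + up_mx (kmulmx (Aexists A cA) x) =
  lo_mx (kmulmx (Achar A cA) x).
Proof.
apply/matrixP => i k; rewrite mxE !lo_kmulmxE up_kmulmxE -big_split /=.
apply: eq_bigr => j _; rewrite !mxE; case: (cA i j).
  by rewrite kscale_kreal0 addr0.
by rewrite kscale_kreal0 add0r lo_kscale_dual.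
Qed.

Lemma up_Achar_split (x : 'cV[R]_n) :
  up_mx (kmulmx (Aforall A cA) x) + lo_mx (kmulmx (Aexists A cA) x) =
  up_mx (kmulmx (Achar A cA) x).
Proof.
apply/matrixP => i k; rewrite mxE !up_kmulmxE lo_kmulmxE -big_split /=.
apply: eq_bigr => j _; rewrite !mxE; case: (cA i j).
  by rewrite kscale_kreal0 addr0.
by rewrite kscale_kreal0 add0r up_kscale_dual.
Qed.

Lemma lo_bchar_split :
  up_mx (bforall b beta) + lo_mx (bexists b beta) = lo_mx (bchar b beta).
Proof.
by apply/matrixP => i k; rewrite !mxE; case: (beta i 0); rewrite ?addr0 ?add0r.
Qed.

Lemma up_bchar_split :
  lo_mx (bforall b beta) + up_mx (bexists b beta) = up_mx (bchar b beta).
Proof.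
by apply/matrixP => i k; rewrite !mxE; case: (beta i 0); rewrite ?addr0 ?add0r.
Qed.

Hypothesis properA : forall i j, proper_itv (A i j).
Hypothesis properb : forall i, proper_itv (b i 0).
Variables (Q : seq (param m n)) (x : 'cV[R]_n).
Hypothesis Q_prefix : is_prefix Q.

Let proper_params p : proper_itv (param_itv A b p).
Proof. by case: p => [[i j]|i]; [apply: properA|apply: properb]. Qed.

Lemma quantified_ge :
  quantified A b cA beta Q (fun A' b' => le_mx b' (A' *m x)) <->
  le_mx (lo_mx (bchar b beta)) (lo_mx (kmulmx (Achar A cA) x)).
Proof.
pose s (p : param m n) := if p is inl ij then x ij.2 0 else -1.
rewrite /quantified (quantify_monotone _ _ _ _ _ _ _ proper_params _ _ s) //; last first.
  move=> w w' s_le le_w i k; have := le_w i k; rewrite (ord1 k) !mxE => le_wi.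
  have := s_le (inr i); rewrite /s !mulN1r lerN2 => /le_trans; apply.
  apply: (le_trans le_wi); apply: ler_sum => j _; rewrite !mxE.
  by rewrite [leLHS]mulrC [leRHS]mulrC; apply: (s_le (inl (i, j))).
set bx := (X in le_mx X _); set Ax := (X in le_mx _ X).
have -> : bx = lo_mx (bchar b beta).
  apply/matrixP => i k; rewrite !mxE /extremal /s /= ler0N1.
  by case: (beta i 0).
suff -> : Ax = lo_mx (kmulmx (Achar A cA) x) by [].
apply/matrixP => i k; rewrite lo_kmulmxE mxE (ord1 k); apply: eq_bigr => j _.
by rewrite lo_kscale !mxE mulrC.
Qed.

(** Reversing the inequalities reverses the weights of all parameters. *)
Lemma quantified_le :
  quantified A b cA beta Q (fun A' b' => le_mx (A' *m x) b') <->
  le_mx (up_mx (kmulmx (Achar A cA) x)) (up_mx (bchar b beta)).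
Proof.
pose s (p : param m n) := if p is inl ij then - x ij.2 0 else 1.
rewrite /quantified (quantify_monotone _ _ _ _ _ _ _ proper_params _ _ s) //; last first.
  move=> w w' s_le le_w i k; have := le_w i k; rewrite (ord1 k) !mxE => le_wi.
  have := s_le (inr i); rewrite /s !mul1r; apply: le_trans.
  apply: le_trans le_wi; apply: ler_sum => j _; rewrite !mxE.
  rewrite [leLHS]mulrC [leRHS]mulrC -lerN2 -!mulNr; exact: (s_le (inl (i, j))).
set Ax := (X in le_mx X _); set bx := (X in le_mx _ X).
have -> : bx = up_mx (bchar b beta).
  apply/matrixP => i k; rewrite !mxE /extremal /s /= ler01.
  by case: (beta i 0).
suff -> : Ax = up_mx (kmulmx (Achar A cA) x) by [].
apply/matrixP => i k; rewrite up_kmulmxE mxE (ord1 k); apply: eq_bigr => j _.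
rewrite up_kscale !mxE mulrC /extremal /s /= oppr_ge0.
(* At [x j 0 = 0] the two sides may pick different endpoints. *)
by case: (ltgtP (x j 0) 0) => [| |->]; rewrite ?mul0r.
Qed.

End Systems.

Theorem theorem2 (R : realType) (m n : nat)
    (A : 'M[kaucher R]_(m, n)) (b : 'cV[kaucher R]_m)
    (hA : forall i j, proper_itv (A i j)) (hb : forall i, proper_itv (b i 0))
    (cA : 'M[quantifier]_(m, n)) (beta : 'cV[quantifier]_m)
    (Q : seq (param m n)) (hQ : is_prefix Q) (x : 'cV[R]_n) :
  ((quantified A b cA beta Q (fun A' b' => le_mx b' (A' *m x)) <->
    le_mx (up_mx (bforall b beta) + lo_mx (bexists b beta))
          (lo_mx (kmulmx (Aforall A cA) x) + up_mx (kmulmx (Aexists A cA) x)))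
   /\
   (le_mx (up_mx (bforall b beta) + lo_mx (bexists b beta))
          (lo_mx (kmulmx (Aforall A cA) x) + up_mx (kmulmx (Aexists A cA) x)) <->
    le_mx (lo_mx (bchar b beta)) (lo_mx (kmulmx (Achar A cA) x))))
  /\
  ((quantified A b cA beta Q (fun A' b' => le_mx (A' *m x) b') <->
    le_mx (up_mx (kmulmx (Aforall A cA) x) + lo_mx (kmulmx (Aexists A cA) x))
          (lo_mx (bforall b beta) + up_mx (bexists b beta)))
   /\
   (le_mx (up_mx (kmulmx (Aforall A cA) x) + lo_mx (kmulmx (Aexists A cA) x))
          (lo_mx (bforall b beta) + up_mx (bexists b beta)) <->
    le_mx (up_mx (kmulmx (Achar A cA) x)) (up_mx (bchar b beta)))).
Proof.
have geP := quantified_ge _ _ _ A b cA beta hA hb Q x hQ.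
have leP := quantified_le _ _ _ A b cA beta hA hb Q x hQ.
by rewrite lo_Achar_split up_Achar_split lo_bchar_split up_bchar_split.
Qed.
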